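(* (1) Let $K$ be a number field. For any integers $u\ge3$ and $t\ge1$ there exists an extension $L/K$ of degree $ut$ with $t_K(L)=t$. (2) Let $K=\mathbb Q$. For every even positive integer $t$ there exists an extension $L/K$ of degree $2t$ with $t_K(L)=t$.
   Context: For a finite extension $L/K$ (inside a fixed algebraic closure), the ascending index $t_K(L)=[F:K]$, where $F$ is the unique subfield of $L$ that is Galois over $K$ of maximum possible degree. *)

(* Defs.v *)
From HB Require Import structures.
From mathcomp Require Import all_boot all_order all_algebra all_field.
Set Implicit Arguments. Unset Strict Implicit. Unset Printing Implicit Defensive.
Import GRing.Theory.
Local Open Scope ring_scope.

(* Ascending index, inside a fixed ambient field M (a finite normal extension
   of Q, standing for the fixed algebraic closure): for K <= L subfields of M,
   [ascending_index_is K L t] says that t = [F : K], where F is a subfield of L,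
   Galois over K, of maximum possible degree among such subfields. *)
Definition ascending_index_is (M : splittingFieldType rat)
    (K L : {vspace M}) (t : nat) : Prop :=
  (exists F : {subfield M},
      [/\ (K <= F)%VS, (F <= L)%VS, galois K F & \dim_K F = t])
  /\ (forall F : {subfield M},
        (K <= F)%VS -> (F <= L)%VS -> galois K F -> (\dim_K F <= t)%N).

(* Main.v *)
Require Import Defs.
From HB Require Import structures.
From mathcomp Require Import all_boot all_order all_algebra all_field.
From mathcomp Require Import all_fingroup all_solvable generic_quotient ring_quotient ring.
From mathcomp Require boolp classical_sets.

(** Let [d = [K0 : Q]].  The number [m = t d] divides [phi(m^2)], so [t] divides the degree over [K] of
    the cyclotomic extension of level [m^2], which is abelian; hence it contains [K1] Galois of degree
    [t] over [K].  Choose an integral generator [kappa] of a Galois number field containing it, two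
    primes [p], [q] modulo which the minimal polynomial of [kappa] is separable and has a root, and by
    the Chinese remainder theorem a monic integral [f] of degree [u] which is [X] times an irreducible
    polynomial modulo [p] and irreducible modulo [q].  Lifts of Frobenius at suitable places above [p]
    and [q] fix [kappa] and permute the roots of [f] as a [(u-1)]-cycle fixing a root [a] and as a
    [u]-cycle.  So the Galois group over [K1] is doubly transitive on the roots, and a normal subgroup
    containing the stabilizer of [a] is everything: no nontrivial subextension of [K1(a) / K1] is
    Galois.

    Over [Q] with [t] even, take instead [K1] real of degree [t] inside a cyclotomic field, containing
    [sqrt 2], and adjoin the real fourth root of 2, which has the non-real conjugate [i 2^(1/4)]. *)

Set Implicit Arguments. Unset Strict Implicit. Unset Printing Implicit Defensive.
Import Order.TTheory GRing.Theory Num.Theory.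
Local Open Scope ring_scope.

(** * Places and lifts of Frobenius *)

(** A non-unit lies in a maximal ideal, found by Zorn's lemma; [k] is the quotient by it. *)
Lemma residue_field_exists (R : comNzRingType) (a : R) :
    (forall b, a * b != 1) ->
  exists (k : fieldType) (phi : {rmorphism R -> k}), phi a = 0.
Proof.
move=> a_nunit.
(* Membership of [a] is asked only of inhabited sets, so that the union of the empty chain satisfies
   [P]. The empty set is not maximal, as the ideal generated by [a] is larger. *)
pose P (X : R -> Prop) := [/\ forall x y, X x -> X y -> X (x + y),
  forall r x, X x -> X (r * x), ~ X 1 & forall x, X x -> X a].
have [F sFP totF|A [[A_D A_M A_1 A_a] A_max]] := @classical_sets.Zorn_bigcup R P.
  split=> [x y [X FX Xx] [Y FY Yy]|r x [X FX Xx]|[X FX X1]|x [X FX Xx]].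
  - have [sXY|sYX] := totF _ _ FX FY.
      by exists Y => //; have [YD _ _ _] := sFP _ FY; apply: YD => //; apply: sXY.
    by exists X => //; have [XD _ _ _] := sFP _ FX; apply: XD => //; apply: sYX.
  - by exists X => //; have [_ XM _ _] := sFP _ FX; apply: XM.
  - by have [_ _ X_1 _] := sFP _ FX; apply: X_1.
  - by exists X => //; have [_ _ _ X_a] := sFP _ FX; apply: X_a Xx.
have Aa : A a.
  apply: boolp.contrapT => nAa.
  apply: (A_max (fun x => exists r, x = r * a)).
    split=> [x Ax|]; first by case: nAa; apply: A_a Ax.
    by move=> sA; apply: nAa; apply: sA; exists 1; rewrite mul1r.
  split=> [_ _ [r ->] [s ->]|r _ [s ->]|[r /esym/eqP]|_ _].
  - by exists (r + s); rewrite mulrDl.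
  - by exists (r * s); rewrite mulrA.
  - by rewrite mulrC (negPf (a_nunit r)).
  - by exists 1; rewrite mul1r.
have A0 : A 0 by rewrite -(mul0r a); apply: A_M.
(* If [x] is outside [A] and not invertible modulo [A], the ideal [A + (x)] is proper and strictly
   larger. *)
have A_inv x : ~ A x -> exists r, A (r * x - 1).
  move=> nAx; apply: boolp.contrapT => no_r.
  apply: (A_max (fun y => exists i r, A i /\ y = i + r * x)).
    split=> [y Ay|]; first by exists y, 0; rewrite mul0r addr0.
    by move=> sA; apply: nAx; apply: sA; exists 0, 1; rewrite mul1r add0r.
  split=> [_ _ [i [r [Ai ->]]] [j [s [Aj ->]]]|c _ [i [r [Ai ->]]]|[i [r [Ai E]]]|_ _].
  - by exists (i + j), (r + s); rewrite mulrDl addrACA; split=> //; apply: A_D.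
  - by exists (c * i), (c * r); rewrite mulrDr mulrA; split=> //; apply: A_M.
  - by apply: no_r; exists r; rewrite E opprD addrCA subrr addr0 -mulN1r; apply: A_M.
  - by exists a, 0; rewrite mul0r addr0.
pose I : R -> bool := fun x => boolp.asbool (A x).
have IP x : reflect (A x) (x \in I) by apply: boolp.asboolP.
have I_ideal : idealr_closed I.
  split; [exact/IP | exact/IP | move=> c x y /IP Ax /IP Ay].
  by apply/IP/A_D => //; apply: A_M.
pose IaM := GRing.isZmodClosed.Build _ I (idealr_closedB I_ideal).
pose IpM := isProperIdeal.Build _ I (idealr_closed_nontrivial I_ideal).
pose Iid : idealr R := HB.pack I IaM IpM.
pose Q : comNzRingType := {ideal_quot Iid}.
pose pi : R -> Q := fun x => (\pi_({ideal_quot Iid}) x)%qT.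
have piB : zmod_morphism pi by move=> x y; rewrite /pi rmorphB.
have piM : monoid_morphism pi by split=> [|x y]; rewrite /pi ?rmorph1 ?rmorphM.
have pi0 : pi 0 = 0 by rewrite -(subrr 0) piB subrr.
have pi_eq0 x : (pi x == 0) = (x \in I).
  by rewrite -pi0 /pi -Quotient.idealrBE subr0.
have Q_inv (x : Q) : exists y : Q, x != 0 -> y * x = 1.
  case: (eqVneq x 0) => [_|]; first by exists 0.
  rewrite -[x]reprK -/(pi _) pi_eq0 => /IP/A_inv[r /IP].
  rewrite -pi_eq0 piB piM.1 piM.2 subr_eq0 => /eqP E.
  by exists (pi r).
have [inv invP] := boolp.choice Q_inv.
pose inv' (x : Q) := if x == 0 then 0 else inv x.
have inv'P (x : Q) : x != 0 -> inv' x * x = 1.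
  by move=> x0; rewrite /inv' (negPf x0) invP.
have inv'0 : inv' 0 = 0 by rewrite /inv' eqxx.
pose kM := GRing.ComNzRing_isField.Build Q inv'P inv'0.
pose k : fieldType := HB.pack {ideal_quot Iid} kM.
pose pik : R -> k := pi.
have piB' : zmod_morphism pik by move=> x y; apply: piB.
have piM' : monoid_morphism pik by split=> [|x y]; [apply: piM.1 | apply: piM.2].
pose m1 := GRing.isZmodMorphism.Build _ _ pik piB'.
pose m2 := GRing.isMonoidMorphism.Build _ _ pik piM'.
exists k, (HB.pack pik m1 m2 : {rmorphism R -> k}).
by apply/eqP; rewrite -[_ == _]/(pi a == 0) pi_eq0; apply/IP.
Qed.

Section AlgebraicIntegers.
Variable L : fieldType.

(** Classical truth values make integrality a boolean predicate, as the subring and subtype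
    structures below require. *)
Definition algint : {pred L} :=
  fun x => boolp.asbool (integralOver (intr : int -> L) x).

Lemma algintP x : reflect (integralOver (intr : int -> L) x) (x \in algint).
Proof. exact: boolp.asboolP. Qed.

Fact algint_subring_closed : subring_closed algint.
Proof.
split=> [|x y /algintP Ox /algintP Oy|x y /algintP Ox /algintP Oy]; apply/algintP.
- exact: integral1.
- exact: integral_sub.
- exact: integral_mul.
Qed.
HB.instance Definition _ := GRing.isSubringClosed.Build L algint algint_subring_closed.

Record integer_ring := IntegerRing {intval : L; _ : intval \in algint}.
HB.instance Definition _ := [isSub for intval].
HB.instance Definition _ := [Choice of integer_ring by <:].
HB.instance Definition _ := [SubChoice_isSubComNzRing of integer_ring by <:].

End AlgebraicIntegers.
Arguments algint {L}.
Arguments algintP {L x}.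

Lemma algint_morph (L L' : fieldType) (f : {rmorphism L -> L'}) x :
  x \in algint -> f x \in algint.
Proof.
move=> /algintP[q q_mon q_x]; apply/algintP; exists q => //.
have -> : map_poly intr q = map_poly f (map_poly intr q).
  by rewrite -map_poly_comp; apply: eq_map_poly => c /=; rewrite rmorph_int.
by rewrite fmorph_root.
Qed.

Section IntegerMap.
Variable L : fieldType.
Local Notation integer_ring := (integer_ring L).

Definition intmap (f : {rmorphism L -> L}) (x : integer_ring) : integer_ring :=
  IntegerRing (algint_morph f (valP x)).

Fact intmap_zmod_morphism f : zmod_morphism (intmap f).
Proof. by move=> x y; apply: val_inj; rewrite /= rmorphB. Qed.
Fact intmap_monoid_morphism f : monoid_morphism (intmap f).
Proof. by split=> [|x y]; apply: val_inj; rewrite /= ?rmorph1 ?rmorphM. Qed.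
HB.instance Definition _ f :=
  GRing.isZmodMorphism.Build _ _ (intmap f) (intmap_zmod_morphism f).
HB.instance Definition _ f :=
  GRing.isMonoidMorphism.Build _ _ (intmap f) (intmap_monoid_morphism f).

End IntegerMap.

Lemma galois_rat (M : splittingFieldType rat) (K : {subfield M}) : galois K {:M}.
Proof.
apply/and3P; split; [exact: subvf | | exact: normalFieldf].
apply/separableP=> x _; apply: pcharf0_separable => p.
by rewrite (pchar_lalg M) pchar_num.
Qed.

(** [Z] is integrally closed; the question is carried to [algC], where rational algebraic integers
    are known to be integers. *)
Lemma algint_rat (M : fieldExtType rat) (x : M) :
  x \in 1%VS -> x \in algint -> exists n : int, x = n%:~R.
Proof.
move=> /vlineP[a ->] /algintP[q q_mon q_a].
have : root (map_poly intr q) (ratr a : algC).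
  move: q_a; rewrite -in_algE.
  have -> : map_poly intr q = map_poly (in_alg M) (map_poly intr q).
    by rewrite -map_poly_comp; apply: eq_map_poly => c /=; rewrite scaler_int.
  rewrite fmorph_root -(fmorph_root (ratr : rat -> algC)) -map_poly_comp.
  by congr root; apply: eq_map_poly => c /=; rewrite rmorph_int.
move/root_monic_Aint => /(_ (monic_map _ q_mon)) Aa.
have /intrP[n Dn] : (ratr a : algC) \is a Num.int.
  apply: Cint_rat_Aint; first exact: Crat_rat.
  by apply: Aa; apply/polyOverP=> i; rewrite coef_map /= intr_int.
exists n; suff -> : a = n%:~R by rewrite scaler_int.
by apply: (fmorph_inj (ratr : {rmorphism rat -> algC})) => /=; rewrite Dn ratr_int.
Qed.

(* For [x] in [O_M[Y]] the polynomial [prod_s (X - s(x))] has coefficients in [Z[Y]], so the set of its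
   roots in [k[Y]] is stable under the Frobenius map of [k] applied coefficientwise. *)
Lemma frobenius_lift (M : splittingFieldType rat) (k : fieldType) (p : nat)
    (phi : {rmorphism integer_ring M -> k}) (x : {poly integer_ring M}) :
    p \in [pchar k] ->
  exists s : gal_of {:M}, forall i, phi (intmap s x`_i) = phi x`_i ^+ p.
Proof.
move=> pchark.
pose conj (s : gal_of {:M}) := map_poly (intmap s).
pose R := \prod_(s : gal_of {:M}) ('X - (conj s x)%:P).
have R_fix (t : gal_of {:M}) : map_poly (conj t) R = R.
  rewrite rmorph_prod /= [RHS](reindex_inj (mulIg t)) /=.
  apply: eq_bigr => s _; rewrite rmorphB /= map_polyX map_polyC /=; congr ('X - _%:P).
  rewrite /conj -map_poly_comp; apply: eq_map_poly => z; apply: val_inj => /=.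
  by rewrite galM ?memvf.
have R_int i j : exists n : int, R`_i`_j = n%:~R.
  have [||n Dn] := @algint_rat M (val R`_i`_j).
  - have /galois_fixedField <- := galois_rat (1%AS : {subfield M}).
    apply/fixedFieldP; rewrite ?memvf // => t _.
    by rewrite -[in RHS](R_fix t) !coef_map.
  - exact: valP.
  - by exists n; apply: val_inj; rewrite Dn rmorph_int.
have [g Dg] : exists g : nat -> nat -> int, forall i j, R`_i`_j = (g i j)%:~R.
  have [g Dg] := boolp.choice (fun ij : nat * nat => R_int ij.1 ij.2).
  by exists (fun i j => g (i, j)) => i j; rewrite -Dg.
pose Rk := map_poly (map_poly phi) R.
pose Fr := map_poly (pFrobenius_aut pchark).
have Rk_Fr : map_poly Fr Rk = Rk.
  by apply/polyP=> i; apply/polyP=> j; rewrite !coef_map /= Dg !rmorph_int.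
have RkE : Rk = \prod_(s : gal_of {:M}) ('X - (map_poly phi (conj s x))%:P).
  rewrite /Rk rmorph_prod; apply: eq_bigr => s _.
  by rewrite rmorphB /= map_polyX map_polyC.
have : Rk.[Fr (map_poly phi x)] == 0.
  rewrite -Rk_Fr horner_map /= RkE horner_prod (bigD1 (1%g : gal_of {:M})) //= hornerXsubC.
  suff -> : conj 1%g x = x by rewrite subrr mul0r rmorph0.
  apply/polyP=> i; rewrite coef_map; apply: val_inj; rewrite /= gal_id //.
(* [k[Y]] is a domain, so one factor vanishes; this equality of polynomials treats all coefficients
   of [x] with the same [s]. *)
rewrite RkE horner_prod => /prodf_eq0[s _]; rewrite hornerXsubC subr_eq0 => /eqP E.
exists s => i; have := congr1 (fun q : {poly k} => q`_i) E.
by rewrite !coef_map /= pFrobenius_autE => ->.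
Qed.

(** [p] is not a unit of [O_M]: its inverse is rational, and would have to be an integer. *)
Lemma place_exists (M : fieldExtType rat) (p : nat) : prime p ->
  exists (k : fieldType) (phi : {rmorphism integer_ring M -> k}), p \in [pchar k].
Proof.
move=> p_pr; have [|k [phi phi_p]] := @residue_field_exists (integer_ring M) p%:R.
  move=> b; apply/eqP => /(congr1 val); rewrite rmorphM rmorph_nat rmorph1 => pb1.
  have pnz : p%:R != 0 :> M.
    by apply/eqP=> p0; move/eqP: pb1; rewrite p0 mul0r eq_sym oner_eq0.
  have Db : val b = (p%:R^-1)%:A.
    apply: (mulfI pnz); rewrite pb1 -in_algE fmorphV /= scaler_nat.
    by rewrite mulfV.
  have [||n Dn] := @algint_rat M (val b); first by rewrite Db memvZ ?mem1v.
    exact: valP.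
  have : (p%:Z * n)%:~R == 1 :> M by rewrite intrM -Dn pb1.
  rewrite -scaler_int -in_algE fmorph_eq1 -[1]/(1%:~R) eqr_int => /eqP/(congr1 absz).
  rewrite abszM /= => /eqP; rewrite muln_eq1 => /andP[/eqP p1 _].
  by rewrite p1 in p_pr.
by exists k, phi; rewrite inE p_pr -(rmorph_nat phi) phi_p eqxx.
Qed.

Lemma pchar_intr_eq0 (k : nzRingType) (p : nat) (n : int) :
  p \in [pchar k] -> (n%:~R == 0 :> k) = (p %| `|n|)%N.
Proof.
move=> pk; rewrite (dvdn_pcharf pk).
by case: n => n; rewrite ?NegzE ?abszN ?mulrNz ?oppr_eq0 -pmulrn.
Qed.

(** The conjugates of an integral element are integral, so the coefficients are both integral and
    rational. *)
Lemma minPoly_algint (M : splittingFieldType rat) (x : M) : x \in algint ->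
  exists m : {poly int}, map_poly intr m = minPoly 1 x.
Proof.
move=> Ox; have g1M := galois_rat (1%AS : {subfield M}).
have [r /= [_ _ Dm]] := elimT (galois_factors (sub1v _)) g1M x (memvf x).
have m_int i : exists n : int, (minPoly 1 x)`_i = n%:~R.
  apply: algint_rat; first exact: (polyOverP (minPolyOver 1%AS x)).
  rewrite Dm; move: i; apply/polyOverP; rewrite big_map; apply: rpred_prod => s _.
  by rewrite polyOverXsubC algint_morph.
have [g Dg] := boolp.choice m_int.
exists (\poly_(i < size (minPoly 1 x)) g i); apply/polyP=> i.
rewrite coef_map coef_poly; case: ltnP => [_ | ge_i]; first by rewrite /= Dg.
by rewrite nth_default.
Qed.

Lemma intval_intr (L : fieldType) (n : int) : val (n%:~R : integer_ring L) = n%:~R.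
Proof. exact: (rmorph_int (val : {rmorphism integer_ring L -> L})). Qed.

(** [m(n)] is the product of the [n - s(kappa)] over the conjugates of [kappa], so any place above
    [p] kills one of these factors; composing it with that [s] gives the required place. *)
Lemma place_above_root (M : splittingFieldType rat) (kappa : integer_ring M)
    (m : {poly int}) (p : nat) (n : int) :
    map_poly intr m = minPoly 1 (val kappa) -> prime p -> (p %| `|m.[n]|)%N ->
  exists (k : fieldType) (phi : {rmorphism integer_ring M -> k}),
    p \in [pchar k] /\ phi kappa = n%:~R.
Proof.
move=> Dm p_pr p_mn; have [k [phi pk]] := place_exists M p_pr.
have g1M := galois_rat (1%AS : {subfield M}).
have [r /= [_ _ Dmin]] := elimT (galois_factors (sub1v _)) g1M _ (memvf (val kappa)).
have mnE : (m.[n]%:~R : integer_ring M) = \prod_(s <- r) (n%:~R - intmap s kappa).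
  apply: val_inj; rewrite intval_intr rmorph_prod /= -horner_map /= Dm Dmin big_map.
  rewrite horner_prod; apply: eq_bigr => s _; rewrite hornerXsubC.
  by congr (_ - _); exact/esym/intval_intr.
have : phi (m.[n]%:~R) == 0 by rewrite rmorph_int (pchar_intr_eq0 _ pk).
rewrite mnE rmorph_prod prodf_seq_eq0 => /hasP[s _ /=].
rewrite rmorphB rmorph_int subr_eq0 => /eqP E.
by exists k, (phi \o intmap s); split=> //=.
Qed.

(** Two distinct roots with the same reduction would give a double root of the reduced
    polynomial. *)
Lemma residue_root_inj (L k : fieldType) (phi : {rmorphism integer_ring L -> k})
    (F : {poly integer_ring L}) :
    separable_poly (map_poly phi F) ->
  {in root F &, forall x y, phi x = phi y -> x = y}.
Proof.
move=> F_sep x y /= Fx0 Fy0 phi_xy; apply/eqP; apply: contraTT F_sep => neq_xy.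
have /factor_theorem[q Dq] := Fx0.
have qy0 : q.[y] = 0.
  apply: val_inj; apply: (@mulIf _ (val (y - x))).
    by rewrite rmorphB subr_eq0 eq_sym (inj_eq val_inj).
  rewrite -rmorphM -(hornerXsubC x y) -hornerM -Dq (rootP Fy0).
  by rewrite rmorph0 mul0r.
rewrite Dq rmorphM rmorphB /= map_polyX map_polyC /= separable_root negb_and negbK.
by rewrite phi_xy /root horner_map /= qy0 rmorph0 eqxx orbT.
Qed.

(** The product of the [X - x^(p^j)] along the Frobenius orbit of [x] has coefficients in [F_p] and
    shares the root [x] with [g], so [g] divides it. Any period [e.+1] will do, not only the
    least. *)
Lemma frobenius_orbit (k : fieldType) (p : nat) (pk : p \in [pchar k])
    (iota : {rmorphism 'F_p -> k}) (g : {poly 'F_p}) (x y : k) (e : nat) :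
    irreducible_poly g -> root (map_poly iota g) x -> root (map_poly iota g) y ->
    x ^+ (p ^ e.+1) = x ->
  exists j, y = x ^+ (p ^ j).
Proof.
move=> g_irr gx0 gy0 xe.
pose h := \prod_(j < e.+1) ('X - (x ^+ (p ^ j))%:P).
have hFr : map_poly (pFrobenius_aut pk) h = h.
  rewrite rmorph_prod [LHS]big_ord_recr [RHS]big_ord_recl mulrC /=; congr (_ * _); last first.
    by rewrite map_polyXsubC /= pFrobenius_autE -exprM -expnSr xe expn0 expr1.
  apply: eq_bigr => j _; rewrite map_polyXsubC /= pFrobenius_autE.
  by rewrite -exprM -expnSr.
have Fp_k (c : k) : c ^+ p = c -> exists a, c = iota a.
  move=> cp; have := congr1 (map_poly iota) (finField_genPoly 'F_p).
  rewrite card_Fp ?(pcharf_prime pk) // rmorph_prod rmorphB /= map_polyXn map_polyX.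
  move/(congr1 (horner^~ c)); rewrite hornerD hornerN hornerXn hornerX cp subrr horner_prod.
  move/esym/eqP/prodf_eq0 => [a _]; rewrite rmorphB /= map_polyX map_polyC hornerXsubC subr_eq0.
  by move/eqP=> ->; exists a.
have h_Fp i : exists a, h`_i = iota a.
  by apply: Fp_k; rewrite -pFrobenius_autE -coef_map hFr.
have [c Dc] := boolp.choice h_Fp.
have [h0 Dh] : exists h0, h = map_poly iota h0.
  exists (\poly_(i < size h) c i); apply/polyP=> i.
  rewrite coef_map coef_poly; case: ltnP => [_ | ge_i]; first exact: Dc.
  by rewrite nth_default //; exact/esym/rmorph0.
have hx0 : root (map_poly iota h0) x.
  by rewrite -Dh /h big_ord_recl rootM expn0 expr1 root_XsubC eqxx.
have g_h0 : g %| h0.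
  have gg : gcdp g h0 %= g.
    apply: g_irr.2 (dvdp_gcdl _ _).
    have : root (map_poly iota (gcdp g h0)) x by rewrite gcdp_map root_gcd gx0.
    by apply: contraTneq => /eqP/size_poly1P[a anz ->]; rewrite map_polyC rootC fmorph_eq0.
  by rewrite -(eqp_dvdl _ gg) dvdp_gcdr.
have : root h y by rewrite Dh; apply: root_dvdp gy0; rewrite dvdp_map.
rewrite /h /root horner_prod => /prodf_eq0[j _]; rewrite hornerXsubC subr_eq0 => /eqP ->.
by exists j.
Qed.

Lemma Fp_morphism_exists (k : fieldType) (p : nat) (pk : p \in [pchar k]) :
  inhabited {rmorphism 'F_p -> k}.
Proof.
pose h : 'F_p -> k := in_alg (pPrimeCharType pk).
have hB : zmod_morphism h by exact: (rmorphB (in_alg (pPrimeCharType pk))).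
have hM : monoid_morphism h.
  by split; [exact: (rmorph1 (in_alg (pPrimeCharType pk))) | exact: (rmorphM (in_alg (pPrimeCharType pk)))].
pose m1 := GRing.isZmodMorphism.Build _ _ h hB.
pose m2 := GRing.isMonoidMorphism.Build _ _ h hM.
by constructor; exact: (HB.pack h m1 m2 : {rmorphism 'F_p -> k}).
Qed.

Lemma map_poly_intr (R S : nzRingType) (h : {rmorphism R -> S}) (f : {poly int}) :
  map_poly h (map_poly intr f) = map_poly intr f.
Proof. by rewrite -map_poly_comp; apply: eq_map_poly => c /=; rewrite rmorph_int. Qed.

(** [s] lifts Frobenius at a place above [p] that sends [kappa] to [n], and [rho] is reduction at
    this place. It is injective on the roots of [f] and turns [s] into Frobenius, so roots that
    reduce to roots of one irreducible factor form a single orbit under [s]. *)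
Lemma frobenius_cycles (M : splittingFieldType rat) (kappa : M) (m f : {poly int})
    (p : nat) (n : int) (rs : seq M) :
    prime p -> kappa \in algint -> map_poly intr m = minPoly 1 kappa ->
    (p %| `|m.[n]|)%N -> separable_poly (map_poly intr m : {poly 'F_p}) ->
    separable_poly (map_poly intr f : {poly 'F_p}) ->
    f \is monic -> map_poly intr f = \prod_(z <- rs) ('X - z%:P) ->
  exists (k : fieldType) (iota : {rmorphism 'F_p -> k}) (rho : M -> k) (s : gal_of {:M}),
    [/\ s \in 'Gal({:M} / <<1; kappa>>)%g,
        {in rs &, injective rho},
        {in rs, forall z, rho (s z) = rho z ^+ p},
        map_poly iota (map_poly intr f) = \prod_(z <- rs) ('X - (rho z)%:P)
      & forall g : {poly 'F_p}, irreducible_poly g ->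
        {in rs &, forall x y, root (map_poly iota g) (rho x) ->
          root (map_poly iota g) (rho y) -> exists j, y = (s ^+ j)%g x}].
Proof.
move=> p_pr Okappa Dm p_mn m_sep f_sep f_mon Df.
pose kappa' : integer_ring M := IntegerRing Okappa.
have [k [phi [pk phi_kappa]]] := place_above_root (Dm : _ = minPoly 1 (val kappa')) p_pr p_mn.
have [iota] := Fp_morphism_exists pk.
have rs_int : {in rs, forall z, z \in algint}.
  by move=> z rs_z; apply/algintP; exists f => //; rewrite Df root_prod_XsubC.
have rs_valK : {in rs, forall z, val (insubd 0 z : integer_ring M) = z}.
  by move=> z rs_z; rewrite insubdK ?rs_int.
pose rs' : seq (integer_ring M) := map (insubd 0) rs.
(* [kappa'] and all the roots are packed as coefficients of one polynomial, to get one [s] for all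
   of them. *)
have [s Ds] := frobenius_lift phi (Poly (kappa' :: rs')) pk.
have{} Ds z : z \in kappa' :: rs' -> phi (intmap s z) = phi z ^+ p.
  by move=> /(nthP 0)[i _ <-]; rewrite -coef_Poly Ds.
have val_root (F : {poly int}) (z : integer_ring M) :
    root (map_poly intr F) z = root (map_poly intr F) (val z).
  rewrite -(map_poly_intr (val : {rmorphism integer_ring M -> M})).
  by rewrite /root horner_map -(inj_eq val_inj) rmorph0.
have phi_sep F : separable_poly (map_poly intr F : {poly 'F_p}) ->
    separable_poly (map_poly phi (map_poly intr F)).
  by move=> ?; rewrite map_poly_intr -(map_poly_intr iota) separable_map.
(* Both [kappa] and its conjugate [s kappa] reduce to [n], since [n ^ p = n] in [k], and reduction
   is injective on the roots of [m]. *)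
have s_fix : s kappa = kappa.
  have := residue_root_inj (phi_sep _ m_sep) (x := intmap s kappa') (y := kappa').
  move=> /(_ _ _ _)/(congr1 val) => /= -> //.
  - rewrite -topredE /= val_root Dm /=.
    by apply: root_minPoly_gal; rewrite ?memvf ?sub1v // gal_kHom ?sub1v // k1AHom.
  - by rewrite -topredE /= val_root Dm root_minPoly.
  - rewrite Ds ?mem_head // phi_kappa.
    by rewrite -(pFrobenius_autE pk) rmorph_int.
have rs_gal (t : gal_of {:M}) z : z \in rs -> t z \in rs.
  rewrite -!root_prod_XsubC -Df => fz0; rewrite -(map_poly_intr (t : {rmorphism M -> M})).
  by rewrite fmorph_root.
(* The elements of [rs] are integral, so on them [insubd] does not fall back on its default 0. *)
pose rho z := phi (insubd 0 z).
have rho_inj : {in rs &, injective rho}.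
  move=> x y rs_x rs_y; rewrite /rho => /(residue_root_inj (phi_sep _ f_sep)) E.
  by rewrite -(rs_valK x rs_x) -(rs_valK y rs_y) E // -topredE /= val_root Df root_prod_XsubC
    rs_valK.
have rho_s : {in rs, forall z, rho (s z) = rho z ^+ p}.
  move=> z rs_z; rewrite /rho -Ds ?inE ?map_f ?orbT //; congr (phi _).
  by apply: val_inj; rewrite /= rs_valK ?rs_gal // rs_valK.
have rho_sj j : {in rs, forall z, rho ((s ^+ j)%g z) = rho z ^+ (p ^ j)}.
  elim: j => [|j IHj] z rs_z; first by rewrite gal_id.
  by rewrite expgSr galM ?memvf // rho_s ?rs_gal // IHj // -exprM -expnSr.
exists k, iota, rho, s; split=> //.
- rewrite gal_kHom ?subvf //; apply/kAHomP=> x.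
  move=> /Fadjoin_polyP[q Kq ->]; rewrite -horner_map /= s_fix; congr horner.
  apply/polyP=> i; rewrite coef_map /=.
  by have /vlineP[a ->] := polyOverP Kq i; rewrite linearZ /= rmorph1.
- rewrite map_poly_intr -(map_poly_intr phi).
  have -> : map_poly intr f = \prod_(z <- rs) ('X - (insubd 0 z : integer_ring M)%:P).
    apply: (map_inj_poly val_inj (rmorph0 val)).
    rewrite (map_poly_intr (val : {rmorphism integer_ring M -> M})) Df.
    rewrite (map_prod_XsubC (val : {rmorphism integer_ring M -> M})).
    by apply: eq_big_seq => z rs_z; congr ('X - _%:P); exact/esym/rs_valK.
  by rewrite map_prod_XsubC.
- move=> g g_irr x y rs_x rs_y gx0 gy0.
  have s_ord : rho x ^+ (p ^ #[s]%g.-1.+1) = rho x.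
    by rewrite prednK ?order_gt0 // -rho_sj // expg_order gal_id.
  have [j Dy] := frobenius_orbit pk g_irr gx0 gy0 s_ord.
  by exists j; apply: rho_inj; rewrite ?rs_gal // rho_sj.
Qed.

(** * Polynomials with prescribed reductions *)

(** [g] is the minimal polynomial of a primitive element of the field with [p ^ d] elements. *)
Lemma irreducible_Fp_exists (p d : nat) : prime p -> (0 < d)%N ->
  exists g : {poly 'F_p},
    [/\ g \is monic, size g = d.+1, irreducible_poly g & separable_poly g].
Proof.
move=> p_pr d_gt0; have [F pF cardF] := pPrimePowerField p_pr d_gt0.
pose L : splittingFieldType 'F_p := pPrimeCharType pF.
have dimL : \dim {:L} = d by rewrite pprimeChar_dimf cardF pfactorK.
have sep1L := (finField_galois (sub1v {:L}%AS)); have /and3P[_ sepL _] := sep1L.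
pose z := separable_generator 1 {:L}.
have genL : <<1; z>>%VS = {:L}%VS by rewrite -eq_adjoin_separable_generator ?sub1v.
have /polyOver1P[g Dg] := minPolyOver 1 z.
have Dg' : minPoly 1 z = map_poly (in_alg L) g by rewrite Dg.
exists g; split.
- by rewrite -(map_monic (in_alg L)) -Dg' monic_minPoly.
- by rewrite -(size_map_poly (in_alg L)) -Dg' size_minPoly adjoin_degreeE genL dimL dimv1 divn1.
- split=> [|q q_nz q_g].
    rewrite -(size_map_poly (in_alg L)) -Dg' size_minPoly.
    by rewrite adjoin_degreeE genL dimL dimv1 divn1.
  have := @minPoly_irr _ _ 1%AS z (map_poly (in_alg L) q).
  rewrite alg_polyOver Dg' dvdp_map q_g eqp_map => /(_ isT isT)/orP[//|].
  by rewrite -(rmorph1 (map_poly (in_alg L))) eqp_map -size_poly_eq1 (negPf q_nz).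
- rewrite -(separable_map (in_alg L)) -Dg'.
  exact: (elimT separableP sepL z (memvf z)).
Qed.

Lemma monic_chinese (p q : nat) (A : {poly 'F_p}) (B : {poly 'F_q}) :
    prime p -> prime q -> p != q -> A \is monic -> B \is monic -> size A = size B ->
  exists f : {poly int}, [/\ f \is monic, size f = size A,
    map_poly intr f = A & map_poly intr f = B].
Proof.
move=> p_pr q_pr neq_pq monA monB szAB.
have co_pq : coprime p q by rewrite prime_coprime // dvdn_prime2.
(* The top coefficient is set to 1 directly: Chinese remaindering controls it only modulo [p * q],
   and [f] must be monic over [Z]. *)
pose c (i : nat) := if i == (size A).-1 then 1%N else chinese p q (A`_i)%R (B`_i)%R.
have szA : (0 < size A)%N by rewrite size_poly_gt0 monic_neq0.
have Fp_mod r (x : 'F_r) (n : nat) : prime r -> n = x %[mod r] -> n%:R = x.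
  by move=> r_pr E; rewrite -[n%:R](Fp_nat_mod r_pr) E Fp_nat_mod // natr_Zp.
have mapf r (C : {poly 'F_r}) : prime r -> C \is monic -> size C = size A ->
    (forall i : nat, i != (size A).-1 -> c i = (C`_i)%R %[mod r]) ->
  map_poly intr (\poly_(i < size A) (c i)%:Z) = C.
  move=> r_pr monC szC cC; apply/polyP=> i; rewrite coef_map coef_poly.
  case: ltnP => [_ | ge_i]; last by rewrite nth_default ?szC ?rmorph0.
  rewrite /= -pmulrn; case: (eqVneq i (size A).-1) => [-> | ne]; last exact/Fp_mod/cC.
  by rewrite /c eqxx -szC -lead_coefE (monicP monC).
have sz : size (\poly_(i < size A) (c i)%:Z) = size A.
  by apply: size_poly_eq; rewrite /c eqxx.
exists (\poly_(i < size A) (c i)%:Z); split=> //.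
- by rewrite monicE lead_coefE sz coef_poly prednK // leqnn /c eqxx.
- apply: mapf => // i ne; rewrite /c (negPf ne) chinese_modl //.
- apply: mapf => // i ne; rewrite /c (negPf ne) chinese_modr //.
Qed.

Lemma exists_cycle_poly (p q u : nat) : prime p -> prime q -> p != q -> (2 < u)%N ->
  exists (f : {poly int}) (g : {poly 'F_p}),
    [/\ f \is monic, size f = u.+1, irreducible_poly g
      & [/\ map_poly intr f = 'X * g, separable_poly ('X * g),
            irreducible_poly (map_poly intr f : {poly 'F_q})
          & separable_poly (map_poly intr f : {poly 'F_q})]].
Proof.
case: u => // d p_pr q_pr neq_pq d_gt1.
have [g [g_mon sz_g g_irr g_sep]] := irreducible_Fp_exists p_pr (ltnW d_gt1).
have [h [h_mon sz_h h_irr h_sep]] := irreducible_Fp_exists q_pr (ltn0Sn d).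
have szXg : size ('X * g) = d.+2 by rewrite mulrC size_mulX ?monic_neq0 ?sz_g.
have [|||f [f_mon sz_f fp fq]] := @monic_chinese p q ('X * g) h p_pr q_pr neq_pq.
- by rewrite monicMr ?monicX.
- by [].
- by rewrite szXg sz_h.
exists f, g; split; rewrite ?fq //; first by rewrite sz_f.
split=> //; have -> : 'X = 'X - 0%:P :> {poly 'F_p} by rewrite subr0.
rewrite mulrC separable_root g_sep /=.
(* An irreducible [g] of degree at least 2 does not vanish at 0, so [X] is not a repeated factor. *)
apply: contraL d_gt1 => /factor_theorem[r]; rewrite subr0 => Dg.
have := g_irr.2 'X; rewrite size_polyX {1}Dg dvdp_mulIr => /(_ isT isT)/eqp_size.
by rewrite sz_g size_polyX => -[<-].
Qed.

(** Clearing denominators in a Bezout relation between [m] and its derivative leaves an integral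
    constant; modulo primes not dividing it the two stay coprime. *)
Lemma separable_mod_p (m : {poly int}) : separable_poly (map_poly intr m : {poly rat}) ->
  exists2 N : nat, (0 < N)%N & forall p, prime p -> ~~ (p %| N)%N ->
    separable_poly (map_poly intr m : {poly 'F_p}).
Proof.
rewrite unlock => m_sep; have [[U V] /= UV] := elimT (Bezout_eq1_coprimepP _ _) m_sep.
have [U' [a a_nz DU]] := rat_poly_scale U; have [V' [b b_nz DV]] := rat_poly_scale V.
have abN : b *: U' * m + a *: V' * m^`() = (a * b)%:P.
  apply: (map_inj_poly (intr_inj : injective (intr : int -> rat)) (rmorph0 _)).
  rewrite [RHS]map_polyC /= -alg_polyC -UV DU DV rmorphD !rmorphM /= !map_polyZ /= -deriv_map.
  rewrite scalerDr -!scalerAl !scalerA mulfK ?intr_eq0 //.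
  by rewrite [_ * _ / _]mulrAC mulfV ?intr_eq0 // mul1r.
exists (absz ((a : int) * b)%R); first by rewrite absz_gt0 mulf_neq0.
move=> p p_pr p_ab; apply/Bezout_coprimepP.
exists (map_poly intr (b *: U'), map_poly intr (a *: V')) => /=.
rewrite deriv_map -!rmorphM -rmorphD abN /= map_polyC /=.
by rewrite polyC_eqp1 (pchar_intr_eq0 _ (pchar_Fp p_pr)).
Qed.

(** Euclid's argument: if [c = m(0)] is nonzero, the value of [m] at a multiple of [c N] is [c]
    times a number congruent to 1 modulo [N], whose prime divisors do not divide [N]. *)
Lemma exists_prime_dvd_value (m : {poly int}) (N : nat) : (1 < size m)%N -> (0 < N)%N ->
  exists p n, [/\ prime p, ~~ (p %| N)%N & (p %| `|m.[n]|)%N].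
Proof.
move=> sz_m N_gt0; pose c := m.[0].
have prime_above_N : exists2 p, prime p & ~~ (p %| N)%N.
  have [p ltNp p_pr] := prime_above N; exists p => //.
  by apply: contraL ltNp => /dvdn_leq; rewrite -leqNgt; apply.
have [c0 | c_nz] := eqVneq c 0.
  by have [p p_pr pN] := prime_above_N; exists p, 0; rewrite -/c c0 dvdn0.
have /factor_theorem[r Dr] : root (m - c%:P) 0.
  by rewrite /root !hornerE subrr.
have mE x : m.[x] = c + x * r.[x].
  have := congr1 (horner^~ x) Dr; rewrite !hornerE => /eqP.
  by rewrite subr_eq addrC mulrC => /eqP.
pose w (y : nat) := 1 + N%:Z * y%:Z * r.[c * N%:Z * y%:Z].
have mw y : m.[c * N%:Z * y%:Z] = c * w y by rewrite mE /w mulrDr mulr1 !mulrA.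
(* More points are tested than [(m - c)(m + c)] has roots, so at one of them [w y] is neither 1 nor
   -1. *)
have [y w_nunit] : exists y, `|w y|%N != 1%N.
  pose P := (m - c%:P) * (m + c%:P).
  have P_nz : P != 0.
    by rewrite mulf_neq0 // -size_poly_gt0 ?size_polyDl ?size_polyN ?size_polyC ?c_nz // ltnW.
  pose s := [seq c * N%:Z * (y : nat)%:Z | y <- iota 0 (size P)].
  have s_uniq : uniq s.
    have cN_nz : c * N%:Z != 0 by rewrite mulf_neq0 // -lt0n.
    by rewrite map_inj_uniq ?iota_uniq // => x y /(mulfI cN_nz)[].
  have /allPn[_ /mapP[y _ ->] not_root] : ~~ all (root P) s.
    by apply: contraL (leqnn (size s)) => Ps; rewrite -ltnNge {2}size_map size_iota max_poly_roots.
  exists y; apply: contra not_root; rewrite /P rootM /root !hornerE mw.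
  have -> : (c * w y - c == 0) = (w y == 1).
    by rewrite subr_eq0 -{2}[c]mulr1 (inj_eq (mulfI c_nz)).
  have -> : (c * w y + c == 0) = (w y == -1).
    by rewrite addr_eq0 -{2}[c]mulr1 -mulrN (inj_eq (mulfI c_nz)).
  by case: (w y) => [[|[|n]]|[|n]].
(* If [w y = 0], every prime divides it and 2 is taken; the final congruence still shows that it
   does not divide [N]. *)
have [p p_pr p_w] : exists2 p, prime p & (p %| `|w y|)%N.
  have [w0 | w_nz] := posnP `|w y|%N; first by exists 2; rewrite ?w0.
  by exists (pdiv `|w y|%N); rewrite ?pdiv_dvd // pdiv_prime // ltn_neqAle eq_sym w_nunit.
exists p, (c * N%:Z * y%:Z); split=> //; last by rewrite mw abszM dvdn_mull.
apply: contraL p_pr => p_N.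
have : (p%:Z %| w y - N%:Z * y%:Z * r.[c * N%:Z * y%:Z])%Z by rewrite rpredB // -mulrA dvdz_mulr.
by rewrite addrK dvdzE absz1 dvdn1 => /eqP p1; rewrite (p1 : p = 1%N).
Qed.

(** * Number fields with prescribed elements *)

(** [L] is [Q[X]] modulo the minimal polynomial of [z], so evaluating representatives at another
    root [y] is well defined. *)
Lemma ahom_exists (L M : fieldExtType rat) (q : {poly rat}) (z : L) (y : M) :
    <<1; z>>%VS = fullv -> map_poly (in_alg L) q = minPoly 1 z ->
    root (map_poly (in_alg M) q) y ->
  exists f : 'AHom(L, M), f z = y.
Proof.
move=> genL Dq qy0.
have ex_r x : exists r : {poly rat}, x = (map_poly (in_alg L) r).[z].
  by apply/Fadjoin1_polyP; rewrite genL memvf.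
have [r Dr] := boolp.choice ex_r.
pose h x := (map_poly (in_alg M) (r x)).[y].
have hE p : h (map_poly (in_alg L) p).[z] = (map_poly (in_alg M) p).[y].
  apply/eqP; rewrite -subr_eq0 -hornerN -hornerD -rmorphB -rootE; apply: root_dvdp qy0.
  rewrite dvdp_map -(dvdp_map (in_alg L)) Dq minPoly_dvdp ?alg_polyOver //.
  by rewrite rootE rmorphB /= !hornerE -Dr subrr.
have hB : zmod_morphism h.
  move=> a b; rewrite [in LHS](Dr a) [in LHS](Dr b) -hornerN -hornerD -rmorphB hE.
  by rewrite rmorphB /= !hornerE.
have hM : monoid_morphism h.
  split=> [|a b].
    have -> : 1 = (map_poly (in_alg L) 1).[z] by rewrite rmorph1 hornerC.
    by rewrite hE rmorph1 hornerC.
  by rewrite [in LHS](Dr a) [in LHS](Dr b) -hornerM -rmorphM hE rmorphM /= hornerM.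
pose m1 := GRing.isZmodMorphism.Build _ _ h hB.
pose m2 := GRing.isMonoidMorphism.Build _ _ h hM.
pose hR : {rmorphism L -> M} := HB.pack h m1 m2.
pose m3 := GRing.isScalable.Build _ _ _ _ h (fmorph_numZ hR).
pose hL : {lrmorphism L -> M} := HB.pack h m1 m2 m3.
exists (linfun_ahom hL); rewrite (lfunE hL) -[LHS]/(h z).
have -> : h z = h (map_poly (in_alg L) 'X).[z] by rewrite map_polyX hornerX.
by rewrite hE map_polyX hornerX.
Qed.

(** Splitting every divisor of [P] lets one field serve several polynomials; [toC] gives access to
    cyclotomic facts and to reality in [algC]. *)
Lemma splitting_field_exists (P : {poly rat}) : P != 0 ->
  exists (M : splittingFieldType rat) (toC : {rmorphism M -> algC}),
    forall A, A %| P -> exists rs : seq M, map_poly (in_alg M) A %= \prod_(z <- rs) ('X - z%:P).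
Proof.
move=> P_nz; have [r Dr] := closed_field_poly_normal (map_poly (ratr : rat -> algC) P).
have [L [toC [rs Drs genL]]] := num_field_exists r.
have PL : map_poly (in_alg L) P %= \prod_(z <- rs) ('X - z%:P).
  rewrite -(eqp_map toC) map_prod_XsubC -(big_map toC xpredT (fun z => 'X - z%:P)) Drs.
  rewrite -map_poly_comp (_ : map_poly _ P = map_poly ratr P); last first.
    by apply: eq_map_poly => c /=; rewrite rmorphZ_num rmorph1 mulr1.
  by rewrite Dr eqp_scale // lead_coef_eq0 map_poly_eq0.
have L_split : SplittingField.axiom L.
  by exists (map_poly (in_alg L) P); [exact: alg_polyOver | exists rs].
pose M : splittingFieldType rat := HB.pack L (FieldExt_isSplittingField.Build rat L L_split).
exists M, toC => A; rewrite -(dvdp_map (in_alg M)) (eqp_dvdr _ PL).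
by move=> /dvdp_prod_XsubC[mk ?]; exists (mask mk rs).
Qed.

Lemma adjoin_generator_rat (L : fieldExtType rat) : exists z : L, <<1; z>>%VS = {:L}%VS.
Proof.
exists (separable_generator 1 {:L}); rewrite -eq_adjoin_separable_generator ?sub1v //.
by apply/separableP=> x _; apply: pcharf0_separable => p; rewrite (pchar_lalg L) pchar_num.
Qed.

Lemma intr_fieldExt_eq0 (L : fieldExtType rat) (n : int) : (n%:~R == 0 :> L) = (n == 0).
Proof. by rewrite -(rmorph_int (in_alg L)) fmorph_eq0 intr_eq0. Qed.

Lemma algint_multiple (L : fieldExtType rat) (x : L) :
  exists2 c : int, c != 0 & c%:~R * x \in algint.
Proof.
have /polyOver1P[q Dq] := minPolyOver 1 x.
have [r [b b_nz Dr]] := rat_poly_scale q.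
have rx0 : root (map_poly intr r) x.
  have := root_minPoly 1 x; rewrite Dq Dr linearZ /= rootZ; last first.
    by rewrite -in_algE fmorph_eq0 invr_eq0 intr_eq0.
  by rewrite -map_poly_comp (eq_map_poly (g := intr)) // => c /=; rewrite scaler_int.
have r_nz : r != 0.
  apply: contraTneq (monic_neq0 (monic_minPoly 1 x)) => r0.
  by rewrite Dq Dr r0 !rmorph0 scaler0 rmorph0 eqxx.
pose c : int := lead_coef r; exists c; first by rewrite lead_coef_eq0.
have sz_r : (1 < size r)%N.
  rewrite ltnNge; apply: contraL rx0 => /size1_polyC Dr0.
  rewrite Dr0 map_polyC rootC /= intr_fieldExt_eq0; apply: contraNneq r_nz => r00.
  by rewrite Dr0 r00.
have [d sz_rd] : exists d, size r = d.+2 by case: (size r) sz_r => [|[|d]] // _; exists d.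
(* [h] is the monic integral polynomial [c^d r(X / c)], which kills [c x]; [e] collects its terms of
   degree at most [d]. *)
pose e : {poly int} := \poly_(i < d.+1) (r`_i * c ^+ (d - i)).
pose h : {poly int} := 'X^(d.+1) + e.
have sz_h : (size e < size ('X^(d.+1) : {poly int}))%N.
  by rewrite size_polyXn ltnS size_poly.
apply/algintP; exists h.
  by rewrite monicE /h lead_coefDl // lead_coefXn.
rewrite /root /h rmorphD /= map_polyXn hornerD hornerXn.
have -> : (map_poly intr e).[c%:~R * x]
   = c%:~R ^+ d * \sum_(i < d.+1) (r`_i)%:~R * x ^+ i.
  rewrite (@horner_coef_wide _ d.+1); last by rewrite (leq_trans (size_poly _ _)) // size_poly.
  rewrite mulr_sumr; apply: eq_bigr => i _.
  rewrite coef_map coef_poly ltn_ord /= intrM rmorphXn /= exprMn.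
  by rewrite -[in X in _ = X * _](subnK (leq_ord i)) exprD; ring.
move: rx0; rewrite /root horner_coef size_map_poly_id0 ?intr_fieldExt_eq0 ?lead_coef_eq0 //.
rewrite sz_rd big_ord_recr /= addr_eq0 coef_map /=.
under eq_bigr do rewrite coef_map /=.
move/eqP=> ->; rewrite exprMn exprSr.
have -> : r`_d.+1 = c by rewrite /c lead_coefE sz_rd.
by apply/eqP; ring.
Qed.

(** * Galois subextensions *)

(** The conjugates over [K] of an element of [E] are its images under [Gal(M / K)], and separability
    is automatic in characteristic 0. *)
Lemma galois_ratP (M : splittingFieldType rat) (K E : {subfield M}) : (K <= E)%VS ->
  reflect (forall s, s \in 'Gal({:M} / K)%g -> {in E, forall x, s x \in E}) (galois K E).
Proof.
move=> sKE; apply: (iffP idP) => [/and3P[_ _ nKE] s Gs x Ex | stable].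
  have := normalField_kAut _ nKE (f := s) (E := {:M}%AS).
  rewrite sKE subvf -gal_kAut ?subvf // Gs => /(_ isT isT)/andP[_ /eqP sE].
  by have := memv_img s Ex; rewrite sE.
have galM := galois_rat K; have [_ sepM nM] := and3P galM.
apply/and3P; split=> //; first by apply: separableSr sepM; apply: subvf.
apply/normalFieldP=> x Ex.
have [r _ Dr] := elimT normalFieldP nM x (memvf x); exists r => //.
apply/allP=> y ry; have [|s Gs <-] := normalField_root_minPoly (subvf K) nM (memvf x) (b := y).
  by rewrite Dr root_prod_XsubC.
exact: stable.
Qed.

Lemma galois_rat_prodv (M : splittingFieldType rat) (K E F : {subfield M}) :
  galois K E -> galois K F -> galois K (E * F)%AS.
Proof.
move=> gE gF; have [[sKE _ _] [sKF _ _]] := (and3P gE, and3P gF).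
have sKEF : (K <= (E * F)%AS)%VS by apply: subv_trans sKE (field_subvMr _ _).
apply/(galois_ratP sKEF) => s Gs x EFx.
have : s x \in (s @: (E * F))%VS by rewrite memv_img.
rewrite aimgM; apply/subvP/prodvS; apply/subvP=> _ /memv_imgP[y Ey ->].
  exact: (elimT (galois_ratP sKE) gE s Gs y Ey).
exact: (elimT (galois_ratP sKF) gF s Gs y Ey).
Qed.

(* The compositum of [K1] with any subfield of [L] Galois over [K] is again Galois over [K]. *)
Lemma ascending_index_tower (M : splittingFieldType rat) (K K1 L : {subfield M}) :
    (K1 <= L)%VS -> galois K K1 ->
    (forall F : {subfield M}, (K1 <= F)%VS -> (F <= L)%VS -> galois K F -> (F <= K1)%VS) ->
  ascending_index_is K L (\dim_K K1).
Proof.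
move=> sK1L galK1 maxK1; have [sKK1 _ _] := and3P galK1.
split=> [|F sKF sFL galF]; first by exists K1.
apply/leq_div2r/dimvS; apply: subv_trans (field_subvMr _ K1) _.
apply: (maxK1 (F * K1)%AS); first exact: field_subvMl.
  by rewrite -(prodv_id L) prodvS.
exact: galois_rat_prodv.
Qed.

Section TwoTransitive.
Variables (M : splittingFieldType rat) (K : {subfield M}) (rs : seq M) (a : M).
Variables (s t : gal_of {:M}).
Hypotheses (rs_uniq : uniq rs) (rs_gt2 : (2 < size rs)%N) (rs_a : a \in rs).
Hypothesis K_rs : \prod_(z <- rs) ('X - z%:P) \is a polyOver K.
Hypotheses (Gs : s \in 'Gal({:M} / K)%g) (Gt : t \in 'Gal({:M} / K)%g).
Hypothesis s_a : s a = a.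
Hypothesis s_cycle : {in rs &, forall x y, x != a -> y != a -> exists j, y = (s ^+ j)%g x}.
Hypothesis t_cycle : {in rs &, forall x y, exists j, y = (t ^+ j)%g x}.

Let rs_gal g : g \in 'Gal({:M} / K)%g -> {in rs, forall z, g z \in rs}.
Proof.
move=> Gg z rs_z; rewrite -!root_prod_XsubC in rs_z *.
by rewrite -(fixedPoly_gal (subvf K) Gg K_rs) fmorph_root.
Qed.

(** The powers of [t] carry [a] to every element of [rs], so all of these are conjugates of [a]. *)
Lemma minPoly_cycle : minPoly K a = \prod_(z <- rs) ('X - z%:P).
Proof.
apply/eqP; rewrite -eqp_monic ?monic_minPoly ?monic_prod_XsubC //.
rewrite /eqp minPoly_dvdp ?root_prod_XsubC //=; apply: uniq_roots_dvdp.
  apply/allP=> z /(t_cycle rs_a)[j ->]; apply: root_minPoly_gal; rewrite ?subvf ?memvf //.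
  exact: groupX.
by rewrite uniq_rootsE.
Qed.

Lemma dim_adjoin_cycle : \dim <<K; a>> = (size rs * \dim K)%N.
Proof.
rewrite dim_Fadjoin; congr (_ * _)%N; apply: succn_inj.
by rewrite -size_minPoly minPoly_cycle size_prod_XsubC.
Qed.

(** [N = Gal(M / F)] is normal in [G] and contains the stabilizer of [a], because [F] lies in
    [K(a)]. A conjugate of [s] belongs to [N] and moves [a]; with the powers of [s] it makes [N]
    transitive on the roots, whence [N = G]. *)
Lemma galois_in_cycle (F : {subfield M}) :
  (K <= F)%VS -> (F <= <<K; a>>)%VS -> galois K F -> (F <= K)%VS.
Proof.
move=> sKF sFa galF; set G := 'Gal({:M} / K)%g.
have sKFM : (K <= F <= {:M})%VS by rewrite sKF subvf.
have [_ _ nF] := and3P galF.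
have /andP[_ nN] : ('Gal({:M} / F) <| G)%g by apply: normalField_normal => //; apply: galois_rat.
have fixN g : g \in G -> g a = a -> g \in 'Gal({:M} / F)%g.
  move=> Gg ga; apply: (subsetP (galS {:M} sFa)).
  rewrite gal_kHom ?subvf //; apply/kAHomP=> _ /Fadjoin_polyP[q Kq ->].
  by rewrite -horner_map /= ga (fixedPoly_gal (subvf K) Gg Kq).
have Ns := fixN s Gs s_a.
have other x : exists2 b, b \in rs & (b != a) && (b != x).
  have /allPn[b rs_b] : ~~ all [in [:: a; x]] rs.
    by apply: contraL rs_gt2 => /allP/(uniq_leq_size rs_uniq); rewrite -leqNgt.
  by rewrite /= !inE negb_or; exists b.
have [b rs_b /andP[ab _]] := other a.
have [j Db] := t_cycle rs_a rs_b; pose c := (t ^+ j)%g.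
have Gc : c \in G by exact: groupX.
have Nsc : (s ^ c)%g \in 'Gal({:M} / F)%g by rewrite memJ_norm // (subsetP nN).
(* If [s ^ c] fixed [a], then [s] would fix [d], a root other than [a]; but [s] cycles those roots,
   and there are at least two. *)
have ca : (s ^ c)%g a != a.
  pose d := (c^-1)%g a; have cd : c d = a by rewrite -galM ?memvf // mulVg gal_id.
  have rs_d : d \in rs by rewrite rs_gal ?groupV.
  apply/eqP; rewrite /conjg !galM ?memvf // -/d -[RHS]cd => /fmorph_inj sd.
  have da : d != a by apply: contraNneq ab => da; rewrite -cd da; apply/eqP.
  have [e rs_e /andP[ea]] := other d; have [i ->] := s_cycle rs_d rs_e da ea.
  case/eqP; elim: i => [|i IHi]; first by rewrite gal_id.
  by rewrite expgS galM ?memvf // sd.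
have N_trans y : y \in rs -> exists2 n, n \in 'Gal({:M} / F)%g & n a = y.
  move=> rs_y; have [-> | y_a] := eqVneq y a; first by exists 1%g; rewrite ?group1 ?gal_id.
  have [|i ->] := s_cycle _ rs_y ca y_a.
    by apply: rs_gal rs_a; rewrite groupJ.
  by exists (s ^ c * s ^+ i)%g; rewrite ?galM ?memvf // groupM // groupX.
(* Each [g] agrees at [a] with some [n] in [N], so [g n^-1] fixes [a] and lies in [N]. *)
have sGN : G \subset 'Gal({:M} / F)%g.
  apply/subsetP=> g Gg; have [n Nn na] := N_trans _ (rs_gal Gg rs_a).
  rewrite -(groupMr _ (groupVr Nn)); apply: fixN.
    by rewrite groupM // groupV (subsetP (galS _ sKF)).
  by rewrite galM ?memvf // -na -galM ?memvf // mulgV gal_id.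
have /galois_fixedField <- := galois_rat K.
have /galois_fixedField <- := galois_rat F.
exact: fixedFieldS.
Qed.

End TwoTransitive.

(** * Cyclotomic extensions *)

(** Induction on the order: divide out a subgroup of prime order [p] dividing [d] and pull back a
    subgroup of order [d / p]. The group type varies because the quotient has its own. *)
Lemma abelian_subgroup_card (gT : finGroupType) (G : {group gT}) (d : nat) :
  abelian G -> (d %| #|G|)%N -> exists2 H : {group gT}, H \subset G & #|H| = d.
Proof.
move: {2}#|G|.+1 (ltnSn #|G|) => n; elim: n gT G d => // n IHn gT G d ltGn cGG dG.
have d_gt0 : (0 < d)%N by apply: dvdn_gt0 dG; apply: cardG_gt0.
have [d1 | d_gt1] := leqP d 1.
  by exists 1%G; rewrite ?sub1G // cards1; apply/eqP; rewrite eqn_leq d1 d_gt0.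
have p_pr := pdiv_prime d_gt1; set p := pdiv d in p_pr.
have [x Gx ox] := Cauchy p_pr (dvdn_trans (pdiv_dvd d) dG).
have sxG : <[x]>%g \subset G by rewrite cycle_subG.
have nxG : (<[x]> <| G)%g by rewrite -sub_abelian_normal.
have cardQ : (#|(G / <[x]>)%g| * p)%N = #|G|.
  by rewrite card_quotient ?normal_norm // -ox mulnC Lagrange.
have dE : (d %/ p * p)%N = d by rewrite divnK // pdiv_dvd.
have [||/= Hb sHb cardHb] := IHn _ (G / <[x]>)%G (d %/ p)%N _ (quotient_abelian _ cGG).
- rewrite -ltnS; apply: leq_trans ltGn; rewrite ltnS -cardQ.
  by rewrite ltn_Pmulr ?prime_gt1 ?cardG_gt0.
- by rewrite -(dvdn_pmul2r (prime_gt0 p_pr)) dE cardQ.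
exists (coset <[x]> @*^-1 Hb)%G.
  by rewrite -(quotientGK nxG) morphpreS.
by rewrite card_cosetpre cardHb -[#|_|]/(#[x]%g) ox mulnC dE.
Qed.

Lemma abelian_subgroup_between (gT : finGroupType) (G C : {group gT}) (d : nat) :
    abelian G -> C \subset G -> (#|C| %| d)%N -> (d %| #|G|)%N ->
  exists H : {group gT}, [/\ C \subset H, H \subset G & #|H| = d].
Proof.
move=> cGG sCG C_d d_G; have nCG : (C <| G)%g by rewrite -sub_abelian_normal.
have [|/= Hb sHb cardHb] := abelian_subgroup_card (d := (d %/ #|C|)%N) (quotient_abelian C cGG).
  rewrite card_quotient ?normal_norm // -(dvdn_pmul2r (cardG_gt0 C)) divnK // mulnC.
  by rewrite Lagrange.
exists (coset C @*^-1 Hb)%G; split; first exact: sub_cosetpre.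
  by rewrite -(quotientGK nCG) morphpreS.
by rewrite card_cosetpre cardHb mulnC divnK.
Qed.

(** Over [Q], [z] and its complex image have the same minimal polynomial, the cyclotomic one. *)
Lemma size_minPoly_prim_root (M : fieldExtType rat) (toC : {rmorphism M -> algC})
    (n : nat) (z : M) :
  n.-primitive_root z -> size (minPoly 1 z) = (totient n).+1.
Proof.
move=> z_prim; have /polyOver1P[q Dq] := minPolyOver 1 z.
have {}Dq : minPoly 1 z = map_poly (in_alg M) q by rewrite Dq.
have mapC (r : {poly rat}) : map_poly toC (map_poly (in_alg M) r) = map_poly ratr r.
  by rewrite -map_poly_comp; apply: eq_map_poly => c /=; rewrite rmorphZ_num rmorph1 mulr1.
have [p [Dp p_mon] dv_p] := minCpolyP (toC z).
have zC_prim : n.-primitive_root (toC z) by rewrite fmorph_primitive_root.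
rewrite -(size_cyclotomic (toC z) n) -(minCpoly_cyclotomic zC_prim) Dp Dq !size_map_poly.
apply/eqp_size/andP; split; last first.
  by rewrite -dv_p -mapC fmorph_root -Dq root_minPoly.
rewrite -(dvdp_map (in_alg M)) -Dq minPoly_dvdp ?alg_polyOver //.
by rewrite -(fmorph_root toC) mapC dv_p.
Qed.

Section CyclotomicExtension.
Variables (M : splittingFieldType rat) (toC : {rmorphism M -> algC}) (n : nat) (z : M).
Hypothesis z_prim : n.-primitive_root z.

Lemma prim_root_gal (s : gal_of {:M}) : exists i, s z = z ^+ i.
Proof.
have : n.-unity_root (s z).
  by apply/unity_rootP; rewrite -rmorphXn (prim_expr_order z_prim) rmorph1.
by move/unity_rootP/(prim_rootP z_prim) => [i ->]; exists i.
Qed.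

Lemma galois_cyclotomic (K : {subfield M}) : galois K <<K; z>>.
Proof.
apply/(galois_ratP (subv_adjoin K z)) => s Gs _ /Fadjoin_polyP[q Kq ->].
have [i sz] := prim_root_gal s.
rewrite -horner_map (fixedPoly_gal (subvf K) Gs Kq) /= sz.
rewrite rpred_horner ?rpredX ?memv_adjoin //.
by apply: (polyOverSv _ Kq); rewrite subv_adjoin.
Qed.

Lemma abelian_cyclotomic (K : {subfield M}) : abelian 'Gal(<<K; z>> / K)%g.
Proof.
have zE (x : gal_of <<K; z>>) : exists i, x z = z ^+ i.
  have : n.-unity_root (x z).
    by apply/unity_rootP; rewrite -rmorphXn (prim_expr_order z_prim) rmorph1.
  by move/unity_rootP/(prim_rootP z_prim) => [i ->]; exists i.
apply/centsP=> x Gx y Gy; apply/eqP; rewrite (gal_adjoin_eq (K := K)) ?groupM //.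
have [[i xz] [j yz]] := (zE x, zE y).
by rewrite !galM ?memv_adjoin // xz yz !rmorphXn /= xz yz -!exprM mulnC.
Qed.

Lemma dim_cyclotomic : \dim <<1; z>> = totient n.
Proof.
apply: succn_inj; rewrite -(size_minPoly_prim_root toC z_prim) size_minPoly.
by rewrite adjoin_degreeE dimv1 divn1.
Qed.

(** [[K(z) : Q]] is a multiple of [totient n], hence of [t [K : Q]], so [t] divides the order of the
    abelian group [Gal(K(z) / K)]; [K1] is the fixed field of a subgroup of index [t]. *)
Lemma galois_sub_cyclotomic (K : {subfield M}) (t : nat) :
    (t * \dim K %| totient n)%N ->
  exists K1 : {subfield M},
    [/\ (K1 <= <<K; z>>)%VS, galois K K1 & \dim_K K1 = t].
Proof.
move=> t_dvd; set E := <<K; z>>%AS; set G := 'Gal(E / K)%G.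
have galE := galois_cyclotomic K; have [sKE _ _] := and3P galE.
have t_G : (t %| #|G|)%N.
  rewrite -(galois_dim galE) -(dvdn_pmul2r (adim_gt0 K)) -dim_sup_field //.
  apply: dvdn_trans t_dvd _; rewrite -dim_cyclotomic; apply: field_dimS.
  by apply/FadjoinP; rewrite sub1v memv_adjoin.
have [H sHG cardH] := abelian_subgroup_card (abelian_cyclotomic K) (dvdn_div t_G).
exists (fixedField_aspace H); split; first exact: fixedField_bound.
  apply: normal_fixedField_galois => //.
  by rewrite -sub_abelian_normal // abelian_cyclotomic.
rewrite dim_fixed_galois // -divgS // cardH; apply/eqP.
by rewrite divnA // mulKn ?cardG_gt0.
Qed.

End CyclotomicExtension.

(** * Extensions of degree [u t], for [u >= 3] *)

(** A prime [p] of exponent [e] in [m] contributes [(p - 1) p^(2e - 1)] to the totient, and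
    [2e - 1 >= e]. *)
Lemma dvdn_totient_sqr (m : nat) : (m %| totient (m ^ 2))%N.
Proof.
have [-> // | m_gt0] := posnP m.
have m2_gt0 : (0 < m ^ 2)%N by rewrite expn_gt0 m_gt0.
rewrite totientE // primesX // [X in (X %| _)%N]prod_prime_decomp // prime_decompE big_map /=.
rewrite !big_seq; apply: (big_ind2 (fun x y => (x %| y)%N)) => // [? ? ? ?|p p_m].
  exact: dvdn_mul.
rewrite dvdn_mull // dvdn_exp2l // lognX.
have : (0 < logn p m)%N by rewrite logn_gt0.
by case: (logn p m) => // e _; rewrite mul2n -addnn addSn /= leq_addl.
Qed.

Lemma number_field_root (M : fieldExtType rat) (A : {poly rat}) (rs : seq M) :
  (1 < size A)%N -> map_poly (in_alg M) A %= \prod_(z <- rs) ('X - z%:P) ->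
  exists z, root (map_poly (in_alg M) A) z.
Proof.
move=> sz_A DA; case: rs DA => [|z rs] DA.
  by move/eqp_size: DA sz_A; rewrite big_nil size_map_poly size_poly1 => ->.
by exists z; rewrite (eqp_root DA) big_cons rootM root_XsubC eqxx.
Qed.

Lemma size_minPoly_gt1 (L : fieldExtType rat) (x : L) : (1 < size (minPoly 1 x))%N.
Proof. by rewrite size_minPoly ltnS adjoin_degreeE dimv1 divn1 adim_gt0. Qed.

Lemma prim_root_Cyclotomic (M : fieldExtType rat) (toC : {rmorphism M -> algC}) (n : nat)
    (z : M) :
  (0 < n)%N -> root (map_poly intr 'Phi_n) z = n.-primitive_root z.
Proof.
move=> n_gt0; have [w w_prim] := C_prim_root_exists n_gt0.
rewrite -(fmorph_root toC) map_poly_intr -(fmorph_primitive_root toC) -(root_cyclotomic w_prim).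
by rewrite -Cintr_Cyclotomic.
Qed.

(* [kappa] comes from an auxiliary splitting field built before the two primes are chosen, since [M]
   depends on the polynomial with roots [rs], hence on the primes. *)
Lemma cyclic_pair_exists (K0 : fieldExtType rat) (n u : nat) : (0 < n)%N -> (2 < u)%N ->
  exists (M : splittingFieldType rat) (toC : {rmorphism M -> algC}) (i0 : 'AHom(K0, M))
      (kappa z a : M) (rs : seq M) (s t : gal_of {:M}),
    [/\ n.-primitive_root z, (<<i0 @: fullv; z>> <= <<1; kappa>>)%VS,
        [/\ uniq rs, size rs = u, a \in rs & \prod_(x <- rs) ('X - x%:P) \is a polyOver 1%VS],
        s \in 'Gal({:M} / <<1; kappa>>)%g /\ t \in 'Gal({:M} / <<1; kappa>>)%g
      & [/\ s a = a,
            {in rs &, forall x y, x != a -> y != a -> exists j, y = (s ^+ j)%g x}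
          & {in rs &, forall x y, exists j, y = (t ^+ j)%g x}]].
Proof.
move=> n_gt0 u_gt2.
have [z0 gen_z0] := adjoin_generator_rat K0.
have /polyOver1P[q0 Dq0] := minPolyOver 1 z0.
pose phi_n : {poly rat} := map_poly intr 'Phi_n.
have phi_nz : phi_n != 0 by rewrite monic_neq0 ?monic_map ?Cyclotomic_monic.
have q0_nz : q0 != 0.
  by apply: contraTneq (monic_neq0 (monic_minPoly 1 z0)); rewrite Dq0 => ->; rewrite rmorph0 eqxx.
(* [M0] is to contain a copy of [K0] and a primitive [n]-th root of unity. *)
have [M0 [toC0 split0]] := splitting_field_exists (mulf_neq0 q0_nz phi_nz).
have [y0 y0_root] : exists y, root (map_poly (in_alg M0) q0) y.
  have [rs Drs] := split0 _ (dvdp_mulr _ (dvdpp q0)).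
  by apply: number_field_root Drs; rewrite -(size_map_poly (in_alg K0)) -Dq0 size_minPoly_gt1.
have [f0 _] := ahom_exists gen_z0 (esym Dq0) y0_root.
have [zeta zeta_prim] : exists z : M0, n.-primitive_root z.
  have [rs Drs] := split0 _ (dvdp_mull _ (dvdpp phi_n)).
  have [|z z_root] := number_field_root _ Drs.
    by rewrite size_map_inj_poly ?rmorph0 ?size_Cyclotomic ?ltnS ?totient_gt0 //; apply: intr_inj.
  exists z; rewrite -(prim_root_Cyclotomic toC0) //.
  by rewrite -(map_poly_intr (in_alg M0)).
have [k0 gen_k0] := adjoin_generator_rat M0.
have [c c_nz Ok] := algint_multiple k0; set kappa0 := c%:~R * k0 in Ok.
have gen_kappa0 : <<1; kappa0>>%VS = {:M0}%VS.
  apply/eqP; rewrite eqEsubv subvf -gen_k0 sub_adjoin1v.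
  have -> : k0 = c%:~R^-1 * kappa0 by rewrite mulKf // intr_fieldExt_eq0.
  by rewrite rpredM ?memv_adjoin // rpredV rpred_int.
have [m Dm] := minPoly_algint Ok.
have DmQ : map_poly (in_alg M0) (map_poly intr m) = minPoly 1 kappa0 by rewrite map_poly_intr.
have m_sep : separable_poly (map_poly intr m : {poly rat}).
  rewrite -(separable_map (in_alg M0)) DmQ.
  have /and3P[_ /separableP sep_kappa0 _] := galois_rat (1%AS : {subfield M0}).
  by apply: sep_kappa0; rewrite memvf.
have sz_m : (1 < size m)%N.
  rewrite -(size_map_inj_poly (intr_inj : injective (intr : int -> rat)) (rmorph0 _)).
  by rewrite -(size_map_poly (in_alg M0)) DmQ size_minPoly_gt1.
have [N N_gt0 sep_p] := separable_mod_p m_sep.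
have [p [np [p_pr pN p_m]]] := exists_prime_dvd_value sz_m N_gt0.
(* Avoiding the divisors of [N * p] makes [q] different from [p]. *)
have [|q [nq [q_pr]]] := exists_prime_dvd_value (N := N * p) sz_m.
  by rewrite muln_gt0 N_gt0 prime_gt0.
rewrite Euclid_dvdM // negb_or => /andP[qN qp] q_m.
have neq_pq : p != q by apply: contraNneq qp => ->.
have [f [g [f_mon sz_f g_irr [fp fp_sep fq_irr fq_sep]]]] := exists_cycle_poly p_pr q_pr neq_pq u_gt2.
pose fQ : {poly rat} := map_poly intr f; pose mQ : {poly rat} := map_poly intr m.
have fQ_nz : fQ != 0 by rewrite monic_neq0 ?monic_map.
have mQ_nz : mQ != 0 by rewrite -size_poly_gt0 -(size_map_poly (in_alg M0)) DmQ ltnW ?size_minPoly_gt1.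
(* The factor [mQ] provides a root [kappa] in [M], and with it an embedding [F] of [M0]. *)
have [M [toC split]] := splitting_field_exists (mulf_neq0 mQ_nz fQ_nz).
have [kappa kappa_root] : exists y, root (map_poly (in_alg M) mQ) y.
  have [rs Drs] := split _ (dvdp_mulr _ (dvdpp mQ)).
  by apply: number_field_root Drs; rewrite -(size_map_poly (in_alg M0)) DmQ size_minPoly_gt1.
have [F Fkappa] := ahom_exists gen_kappa0 DmQ kappa_root.
have DmM : map_poly intr m = minPoly 1 kappa.
  by rewrite -Fkappa -(aimg1 F) -map_minPoly -Dm map_poly_intr.
have OkM : kappa \in algint by rewrite -Fkappa (algint_morph F).
have [rs Drs0] := split _ (dvdp_mull _ (dvdpp fQ)).
have Drs : map_poly intr f = \prod_(x <- rs) ('X - x%:P).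
  apply/eqP; rewrite -eqp_monic ?monic_prod_XsubC ?monic_map //.
  by rewrite -(map_poly_intr (in_alg M)).
have f_sep : separable_poly (map_poly intr f : {poly 'F_p}) by rewrite fp.
have [k [iota [rho [s [Gs rho_inj rho_s f_rho s_cycle]]]]] :=
  frobenius_cycles p_pr OkM DmM p_m (sep_p p p_pr pN) f_sep f_mon Drs.
have [k' [iota' [rho' [t [Gt rho'_inj rho'_t f_rho' t_cycle]]]]] :=
  frobenius_cycles q_pr OkM DmM q_m (sep_p q q_pr qN) fq_sep f_mon Drs.
have root_rho x : x \in rs -> root (map_poly iota (map_poly intr f)) (rho x).
  by move=> rs_x; rewrite f_rho -(big_map rho xpredT (fun y => 'X - y%:P)) root_prod_XsubC map_f.
have root_rho' x : x \in rs -> root (map_poly iota' (map_poly intr f)) (rho' x).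
  by move=> rs_x; rewrite f_rho' -(big_map rho' xpredT (fun y => 'X - y%:P)) root_prod_XsubC map_f.
have rs_uniq : uniq rs.
  apply: (@map_uniq _ _ rho); rewrite -separable_prod_XsubC big_map -f_rho.
  by rewrite separable_map.
have sz_rs : size rs = u.
  apply: succn_inj; rewrite -sz_f -(size_prod_XsubC rs id) -Drs -(map_poly_intr (in_alg M)).
  by rewrite size_map_poly size_map_inj_poly ?rmorph0 //; apply: intr_inj.
(* [a] is the root reducing to 0, from the factor [X]; Frobenius fixes 0, so [s] fixes [a]. The
   other roots reduce to roots of [g] and form one orbit. *)
have [a rs_a rho_a] : exists2 a, a \in rs & 0 = rho a.
  apply/mapP; rewrite -root_prod_XsubC big_map -f_rho fp rmorphM /= map_polyX.
  by rewrite rootM rootX eqxx.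
have rs_s x : x \in rs -> s x \in rs.
  rewrite -!root_prod_XsubC -Drs => fx0; rewrite -(map_poly_intr (s : {rmorphism M -> M})).
  by rewrite fmorph_root.
have s_a : s a = a.
  by apply: rho_inj; rewrite ?rs_s // rho_s // -rho_a expr0n eqn0Ngt prime_gt0.
have g_rho x : x \in rs -> x != a -> root (map_poly iota g) (rho x).
  move=> rs_x xa; have := root_rho x rs_x.
  rewrite fp rmorphM /= map_polyX rootM rootX rho_a (inj_in_eq rho_inj) // (negPf xa).
  by [].
exists M, toC, (F \o f0)%AF, kappa, (F zeta), a, rs, s, t; split=> //.
- by rewrite fmorph_primitive_root.
- have -> : <<1; kappa>>%VS = (F @: {:M0})%VS by rewrite -gen_kappa0 aimg_adjoin aimg1 Fkappa.
  apply/FadjoinP; split; last by rewrite memv_img ?memvf.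
  by rewrite /= limg_comp limgS ?subvf.
- split=> //; rewrite -Drs; apply/polyOverP=> i.
  by rewrite coef_map rpred_int.
- split=> // x y rs_x rs_y; first by move=> xa ya; apply: (s_cycle g); rewrite ?g_rho.
  by apply: (t_cycle (map_poly intr f)); rewrite ?root_rho'.
Qed.

Lemma ascending_index_existence (K0 : fieldExtType rat) (u t : nat) :
    (3 <= u)%N -> (1 <= t)%N ->
  exists (M : splittingFieldType rat) (f : 'AHom(K0, M)) (L : {subfield M}),
    [/\ (f @: fullv <= L)%VS,
        \dim_(f @: fullv) L = (u * t)%N
      & ascending_index_is (f @: fullv)%VS L t].
Proof.
move=> u_gt2 t_gt0; pose d := \dim {:K0}; pose n := ((t * d) ^ 2)%N.
have n_gt0 : (0 < n)%N by rewrite expn_gt0 muln_gt0 t_gt0 adim_gt0.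
have [M [toC [i0 [kappa [z [a [rs [s [t' [z_prim sub_kappa [rs_uniq sz_rs rs_a rs_Q] [Gs Gt]]]]]]]]]]] :=
  cyclic_pair_exists K0 n_gt0 u_gt2.
move=> [s_a s_cycle t_cycle]; pose K : {subfield M} := (i0 @: fullv)%AS.
have dimK : \dim K = d by rewrite limg_dim_eq // (eqP (AHom_lker0 i0)) capv0.
have [|K1 [sK1 galK1 dimK1]] := @galois_sub_cyclotomic M toC n z z_prim K t.
  by rewrite dimK dvdn_totient_sqr.
have [sKK1 _ _] := and3P galK1.
(* Both lifts fix [kappa], so this inclusion places them in [Gal(M / K1)]. *)
have sK1_kappa : (K1 <= <<1; kappa>>)%VS := subv_trans sK1 sub_kappa.
have G1 g : g \in 'Gal({:M} / <<1; kappa>>)%g -> g \in 'Gal({:M} / K1)%g.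
  exact: (subsetP (galS {:M} sK1_kappa)).
have K1_rs : \prod_(x <- rs) ('X - x%:P) \is a polyOver K1.
  by apply: (polyOverSv _ rs_Q); rewrite sub1v.
exists M, i0, <<K1; a>>%AS; split; first exact: subv_trans (subv_adjoin _ _).
  rewrite -[(i0 @: fullv)%VS]/(K : {vspace M}).
  rewrite (dim_adjoin_cycle rs_uniq rs_a K1_rs (G1 _ Gt) t_cycle) sz_rs.
  by rewrite (dim_sup_field sKK1) dimK1 mulnA mulnK // adim_gt0.
rewrite -[(i0 @: fullv)%VS]/(K : {vspace M}) -dimK1.
apply: ascending_index_tower => // [|F sK1F sFa galF]; first exact: subv_adjoin.
have galF1 : galois K1 F by apply: galoisS galF; rewrite sKK1.
apply: (galois_in_cycle rs_uniq _ rs_a K1_rs (G1 _ Gs) (G1 _ Gt) s_a s_cycle t_cycle) => //.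
by rewrite sz_rs.
Qed.

(** * Extensions of degree [2 t] of the rationals *)

Lemma minPoly_sqrt (F0 : fieldType) (L : fieldExtType F0) (K : {subfield L}) (x : L) :
  x ^+ 2 \in K -> x \notin K -> minPoly K x = 'X^2 - (x ^+ 2)%:P.
Proof.
move=> Kx2 nKx; have sz : size ('X^2 - (x ^+ 2)%:P) = 3 by rewrite size_XnsubC.
have mon : 'X^2 - (x ^+ 2)%:P \is monic by rewrite monicXnsubC.
have dvd : minPoly K x %| 'X^2 - (x ^+ 2)%:P.
  by rewrite minPoly_dvdp ?rpredB ?rpredX ?polyOverX ?polyOverC // /root !hornerE subrr.
apply/eqP; rewrite -eqp_monic ?monic_minPoly // -dvdp_size_eqp // sz eqn_leq.
have := dvdp_leq (monic_neq0 mon) dvd; rewrite sz => -> /=.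
rewrite size_minPoly ltnS ltn_neqAle adjoin_degreeE divn_gt0 ?adim_gt0 //.
rewrite dimvS ?subv_adjoin // andbT -adjoin_degreeE eq_sym.
by rewrite adjoin_deg_eq1.
Qed.

Lemma sqrt2_irrational (L : fieldExtType rat) (b : L) : b ^+ 2 = 2%:R -> b \notin 1%VS.
Proof.
move=> b2; apply/negP=> Qb; have [|n Dn] := algint_rat Qb.
  apply/algintP; exists ('X^2 - 2%:R%:P); first exact: monicXnsubC.
  by rewrite rmorphB /= map_polyXn map_polyC /= /root !hornerE b2 subrr.
have : (n ^+ 2 - 2%:R)%:~R == 0 :> L by rewrite rmorphB rmorphXn /= -Dn b2 subrr.
rewrite intr_fieldExt_eq0 subr_eq0 => /eqP/(congr1 absz); rewrite abszX.
case: `|n|%N => [|[|m]] // m2.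
suff : (2 ^ 2 <= m.+2 ^ 2)%N by rewrite m2.
by rewrite leq_exp2r.
Qed.

(** For a primitive eighth root of unity [e], [e^4 = -1] gives [(e + 1/e)^2 = 2], so [b] is
    [e + 1/e] up to sign. *)
Lemma sqrt2_cyclotomic (L : fieldExtType rat) (n : nat) (z b : L) :
  n.-primitive_root z -> (8 %| n)%N -> b ^+ 2 = 2%:R -> b \in <<1; z>>%VS.
Proof.
move=> z_prim n8 b2; pose e := z ^+ (n %/ 8).
have e_prim : 8.-primitive_root e by exact: dvdn_prim_root.
have e4 : e ^+ 4 = -1.
  have : (e ^+ 4 - 1) * (e ^+ 4 + 1) == 0.
    have -> : (e ^+ 4 - 1) * (e ^+ 4 + 1) = e ^+ 8 - 1 by ring.
    by rewrite prim_expr_order // subrr.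
  rewrite mulf_eq0 subr_eq0 addr_eq0 => /orP[|/eqP //].
  by rewrite -(prim_order_dvd e_prim).
have e_nz : e != 0.
  by apply/eqP=> e0; move/eqP: e4; rewrite e0 expr0n eq_sym oppr_eq0 oner_eq0.
have De : (e + e^-1) ^+ 2 = 2%:R.
  have -> : (e + e^-1) ^+ 2 = 2%:R + (e ^+ 4 + 1) / e ^+ 2 by field.
  by rewrite e4 addNr mul0r addr0.
have : (b - (e + e^-1)) * (b + (e + e^-1)) == 0.
  have -> : (b - (e + e^-1)) * (b + (e + e^-1)) = b ^+ 2 - (e + e^-1) ^+ 2 by ring.
  by rewrite b2 De subrr.
have Ee : e + e^-1 \in <<1; z>>%VS by rewrite rpredD ?rpredV ?rpredX ?memv_adjoin.
by rewrite mulf_eq0 subr_eq0 addr_eq0 => /orP[] /eqP -> //; rewrite rpredN.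
Qed.

(** [M] is normal over [Q], so complex conjugation preserves its image in [algC]. *)
Lemma conj_gal_exists (M : splittingFieldType rat) (toC : {rmorphism M -> algC}) :
  exists2 c : gal_of {:M}, c \in 'Gal({:M} / 1)%g & forall x, toC (c x) = (toC x)^*%C.
Proof.
have [nu Dnu] := restrict_aut_to_normal_num_field toC Num.conj.
have nuM : kHom 1 {:M} (linfun nu).
  by apply/kHom_monoid_morphism; split=> [|x y]; rewrite !lfunE ?rmorph1 ?rmorphM.
have [|c Gc Dc] := @kAut_to_gal _ _ 1%AS {:M}%AS (linfun nu); first by rewrite kAutfE.
by exists c => // x; rewrite -Dc ?memvf // lfunE Dnu.
Qed.

(* The obstruction is that [r] has a non-real conjugate, [i r] or [- i r]. *)
Lemma real_fourth_root_not_galois (M : splittingFieldType rat) (toC : {rmorphism M -> algC})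
    (c : gal_of {:M}) (r : M) (F : {subfield M}) :
    (forall x, toC (c x) = (toC x)^*%C) -> r ^+ 4 = 2%:R -> toC r \is Num.real ->
    galois 1 F -> (forall x, x \in F -> c x = x) -> r \notin F.
Proof.
move=> Dc r4 r_real galF F_real; apply/negP=> Fr.
have b2 : (r ^+ 2) ^+ 2 = 2%:R by rewrite -exprM.
have nQb := sqrt2_irrational b2.
have Db : minPoly 1 (r ^+ 2) = 'X^2 - ((r ^+ 2) ^+ 2)%:P.
  by apply: minPoly_sqrt => //; rewrite b2 rpred_nat.
have [_ _ nM] := and3P (galois_rat (1%AS : {subfield M})).
(* [s] negates the square root of 2, so [(s r)^2] is negative, although [s r] would lie in the real
   field [F]. *)
have [|s Gs sb] := normalField_root_minPoly (sub1v _) nM (memvf (r ^+ 2)) (b := - r ^+ 2).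
  by rewrite Db /root !hornerE sqrrN subrr.
have Fsr : s r \in F by apply: (elimT (galois_ratP (sub1v F)) galF s Gs).
have sr_real : toC (s r) \is Num.real.
  by rewrite CrealE -Dc F_real.
have r_nz : r != 0.
  by apply: contraNneq nQb => ->; rewrite expr0n mem0v.
have : 0 <= toC (s r) ^+ 2 by rewrite real_exprn_even_ge0.
rewrite -rmorphXn -rmorphXn /= sb rmorphN oppr_ge0 rmorphXn => le0.
have gt0 : 0 < toC r ^+ 2 by rewrite real_exprn_even_gt0 // fmorph_eq0.
by have := lt_le_trans gt0 le0; rewrite ltxx.
Qed.

Lemma ascending_index_rat_existence (t : nat) : (0 < t)%N -> ~~ odd t ->
  exists (M : splittingFieldType rat) (L : {subfield M}),
    \dim L = (2 * t)%N /\ ascending_index_is 1%VS L t.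
Proof.
(* This level is divisible by 8, which brings in [sqrt 2], and its totient by [4 t]. *)
move=> t_gt0 t_even; pose n := ((4 * t) ^ 2)%N.
have n_gt0 : (0 < n)%N by rewrite expn_gt0 muln_gt0 t_gt0.
have phi_4t : (4 * t %| totient n)%N by apply: dvdn_totient_sqr.
pose phi_n : {poly rat} := map_poly intr 'Phi_n.
have phi_nz : phi_n != 0 by rewrite monic_neq0 ?monic_map ?Cyclotomic_monic.
pose q4 : {poly rat} := 'X^4 - 2%:R%:P.
have q4_mon : q4 \is monic by apply: monicXnsubC.
have [M [toC split]] := splitting_field_exists (mulf_neq0 phi_nz (monic_neq0 q4_mon)).
have [z z_prim] : exists z : M, n.-primitive_root z.
  have [rs Drs] := split _ (dvdp_mulr _ (dvdpp phi_n)).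
  have [|z z_root] := number_field_root _ Drs.
    by rewrite size_map_inj_poly ?rmorph0 ?size_Cyclotomic ?ltnS ?totient_gt0 //; apply: intr_inj.
  exists z; rewrite -(prim_root_Cyclotomic toC) //.
  by rewrite -(map_poly_intr (in_alg M)).
have [r Dr] : exists r : M, toC r = sqrtC (sqrtC 2%:R).
  have [rs Drs] := split _ (dvdp_mull _ (dvdpp q4)).
  have : root (map_poly toC (map_poly (in_alg M) q4)) (sqrtC (sqrtC 2%:R)).
    rewrite /q4 !rmorphB /= !map_polyXn !map_polyC /= scaler_nat rmorph_nat.
    by rewrite /root !hornerE (exprM _ 2 2) !sqrtCK subrr.
  rewrite -(eqp_map toC) map_prod_XsubC in Drs; rewrite (eqp_root Drs).
  by rewrite -(big_map toC xpredT (fun x => 'X - x%:P)) root_prod_XsubC => /mapP[r _ ->]; exists r.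
have r_real : toC r \is Num.real by rewrite Dr ger0_real // !sqrtC_ge0 ler0n.
have r4 : r ^+ 4 = 2%:R.
  by apply: (fmorph_inj toC); rewrite rmorphXn /= Dr rmorph_nat (exprM _ 2 2) !sqrtCK.
have [c Gc Dc] := conj_gal_exists toC.
have c_r : c r = r by apply: (fmorph_inj toC); rewrite Dc; apply/CrealP.
pose b := r ^+ 2; have b2 : b ^+ 2 = 2%:R by rewrite -exprM.
have nQb := sqrt2_irrational b2.
pose E := <<1; z>>%AS; pose A := 'Gal(E / 1)%G.
have galE : galois 1 E := galois_cyclotomic z_prim 1.
have [sQE _ nE] := and3P galE.
have Eb : b \in E by apply: sqrt2_cyclotomic z_prim _ b2; rewrite /n expnMn -mulnn dvdn_mulr.
pose B := <<1; b>>%AS.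
have sBE : (B <= E)%VS by rewrite sub_adjoin1v.
have dimB : \dim B = 2%N.
  rewrite dim_Fadjoin dimv1 muln1; apply: succn_inj; rewrite -size_minPoly.
  by rewrite minPoly_sqrt ?size_XnsubC // b2 rpred_nat.
have [cE GcE DcE] : {cE | cE \in 'Gal(E / 1)%g & {in E, c =1 cE}}.
  apply: kHom_to_gal => //; first by rewrite sQE subvv.
  by rewrite k1AHom.
have cardA : #|A| = totient n.
  by rewrite -(galois_dim galE) dimv1 divn1 (dim_cyclotomic toC z_prim).
have cE_B : cE \in 'Gal(E / B)%g.
  rewrite gal_kHom //; apply/kAHomP=> x Bx; rewrite -DcE ?(subvP sBE) //.
  move: Bx => /Fadjoin_polyP[q Qq ->].
  by rewrite -horner_map /= (fixedPoly_gal (sub1v _) Gc Qq) rmorphXn /= c_r.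
have ord_cE : (#|<[cE]>%g| %| 2)%N.
  rewrite -[#|_|]/(#[cE]%g) order_dvdn; apply/gal_eqP=> x Ex.
  rewrite expgS expg1 galM // -!DcE ?memv_gal ?gal_id //; last by rewrite DcE ?memv_gal.
  by apply: (fmorph_inj toC); rewrite !Dc conjCK.
have sBA : 'Gal(E / B)%g \subset A by apply: galS; apply: sub1v.
have cardB : (#|'Gal(E / B)%g| * 2)%N = totient n.
  have galBE : galois B E by apply: galoisS galE; rewrite sub1v sBE.
  rewrite -(galois_dim galBE) -dimB -dim_sup_field //.
  exact: (dim_cyclotomic toC z_prim).
have [t2 Dt2] : exists t2, t = (t2 * 2)%N by exists t./2; rewrite muln2 -[LHS]odd_double_half (negPf t_even).
have [w Dw] := dvdnP phi_4t.
(* As [totient n = 4 w t], order [4 w] means index [t]. It divides the order [2 w t] of [Gal(E / B)]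
   because [t] is even. Containing conjugation makes the fixed field real; lying in [Gal(E / B)]
   puts [b] in it. *)
have [||||H [sCH sHB cardH]] := @abelian_subgroup_between _ 'Gal(E / B)%G <[cE]>%G (w * 4)%N.
- exact: abelianS sBA (abelian_cyclotomic z_prim 1).
- by rewrite cycle_subG.
- by apply: dvdn_trans ord_cE _; rewrite dvdn_mull.
- rewrite -(dvdn_pmul2r (isT : 0 < 2)%N) cardB Dw Dt2.
  by apply/dvdnP; exists t2; ring.
have sHA : H \subset A := subset_trans sHB sBA.
pose K1 : {subfield M} := (fixedField_aspace H).
have sK1E : (K1 <= E)%VS by apply: fixedField_bound.
have galK1 : galois 1 K1.
  apply: normal_fixedField_galois => //.
  by rewrite -sub_abelian_normal // (abelian_cyclotomic z_prim).
have dimK1 : \dim K1 = t.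
  have := dim_fixed_galois galE sHA; rewrite dimv1 divn1 -divgS // cardH cardA Dw => ->.
  have w_gt0 : (0 < w)%N by move: (totient_gt0 n); rewrite n_gt0 Dw muln_gt0 => /andP[].
  by rewrite mulnA mulKn // muln_gt0 w_gt0.
have K1b : b \in K1.
  apply/fixedFieldP=> // x Hx; apply: (fixed_gal sBE (subsetP sHB x Hx)).
  exact: memv_adjoin.
have K1_real x : x \in K1 -> c x = x.
  move=> K1x; rewrite DcE ?(subvP sK1E) //.
  have /mem_fixedFieldP[_] := K1x; apply.
  by apply: (subsetP sCH); apply: cycle_id.
pose L := <<K1; r>>%AS.
have L_real x : x \in L -> c x = x.
  move=> /Fadjoin_polyP[q K1q ->]; rewrite -horner_map /= c_r; congr horner.
  by apply/polyP=> i; rewrite coef_map /= K1_real // (polyOverP K1q).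
have no_r (F : {subfield M}) : (F <= L)%VS -> galois 1 F -> r \notin F.
  move=> sFL galF; apply: (real_fourth_root_not_galois Dc r4 r_real galF) => x Fx.
  by apply: L_real; apply: (subvP sFL).
have dimL : \dim L = (2 * \dim K1)%N.
  rewrite dim_Fadjoin; congr (_ * _)%N; apply: succn_inj; rewrite -size_minPoly.
  by rewrite minPoly_sqrt ?size_XnsubC // no_r ?subv_adjoin.
exists M, L; split; first by rewrite dimL dimK1.
have <- : \dim_(1%VS : {vspace M}) K1 = t by rewrite dimv1 divn1.
apply: (@ascending_index_tower _ 1%AS).
- exact: subv_adjoin.
- exact: galK1.
(* Since [[L : K1] = 2], [F] is [K1] or [L], and [L] is excluded because it contains [r]. *)
move=> F sK1F sFL galF; have : \dim F != \dim L.
  apply: contra (no_r F sFL galF) => dimFL.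
  have /eqP -> : F == L :> {vspace M} by rewrite eqEdim sFL (eqP dimFL) leqnn.
  exact: memv_adjoin.
rewrite (dim_sup_field sK1F) dimL eqn_pmul2r ?adim_gt0 // => not2.
have := dimvS sFL; rewrite (dim_sup_field sK1F) dimL leq_pmul2r ?adim_gt0 // => le2.
rewrite -(geq_leqif (dimv_leqif_sup sK1F)) (dim_sup_field sK1F).
by rewrite -[leqRHS]mul1n leq_pmul2r ?adim_gt0 //; move: (\dim_K1 F) not2 le2 => [|[|[|]]].
Qed.

Local Close Scope ring_scope.

Theorem theorem9p7 :
  (* (1) K a number field (finite extension K0 of Q), embedded by f into an
     ambient number field M; L/K of degree u t with ascending index t. *)
  (forall (K0 : fieldExtType rat) (u t : nat), (3 <= u)%N -> (1 <= t)%N ->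
     exists (M : splittingFieldType rat) (f : 'AHom(K0, M)) (L : {subfield M}),
       [/\ (f @: fullv <= L)%VS,
           \dim_(f @: fullv) L = (u * t)%N
         & ascending_index_is (f @: fullv)%VS L t])
  /\
  (* (2) K = Q. *)
  (forall t : nat, (0 < t)%N -> ~~ odd t ->
     exists (M : splittingFieldType rat) (L : {subfield M}),
       \dim L = (2 * t)%N /\ ascending_index_is 1%VS L t).
Proof.
split; [exact: ascending_index_existence | exact: ascending_index_rat_existence].
Qed.
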